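(* Let $\mathcal{R}_{\mathrm{SI}}=\{(\xi(C),\psi(C)) : C\in\mathcal{C}_{\mathrm{SI}}\}$. Then \[ \mathcal{R}_{\mathrm{SI}}=\{(x,y)\in[0,1]^2 : x\le y\le\sqrt{x}\}. \] Moreover, the upper boundary $y=\sqrt{x}$ is attained (for each $x\in[0,1]$) uniquely by the Fréchet copula $C^{\mathrm{Fr}}_{\sqrt{x}}$, where $C^{\mathrm{Fr}}_\alpha(u,v)=(1-\alpha)uv+\alpha\min(u,v)$, and every ordinal sum of $\Pi$ satisfies $\xi=\psi$, with every point $(y,y)$, $y\in[0,1]$, of the lower boundary attained by some ordinal sum of $\Pi$.
   Context: $\mathcal{C}$ is the set of bivariate copulas; $\xi(C)=6\int_0^1\int_0^1(\partial_1C(u,v))^2\,du\,dv-2$, $\psi(C)=6\int_0^1C(u,u)\,du-2$. A copula is stochastically increasing (SI) if for every $v$ the map $u\mapsto\partial_1C(u,v)$ is non-increasing outside a Lebesgue-null set; $\mathcal{C}_{\mathrm{SI}}$ is the set of SI copulas. $\Pi(u,v)=uv$, $M(u,v)=\min(u,v)$. For a countable family of disjoint open intervals $(a_k,b_k)\subset(0,1)$, $k\in I$, and copulas $C_k$, the ordinal sum $(\langle a_k,b_k\rangle,C_k)_{k\in I}$ is the copula equal to $a_k+(b_k-a_k)C_k\big(\tfrac{u-a_k}{b_k-a_k},\tfrac{v-a_k}{b_k-a_k}\big)$ for $(u,v)\in(a_k,b_k)^2$ and to $M(u,v)$ otherwise; if all $C_k=\Pi$ it is called an ordinal sum of $\Pi$.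 *)

(* Defs.v *)
From HB Require Import structures.
From mathcomp Require Import all_boot all_order all_algebra.
From mathcomp Require Import all_classical all_reals all_analysis.
Set Implicit Arguments. Unset Strict Implicit. Unset Printing Implicit Defensive.
Import Order.TTheory GRing.Theory Num.Theory.
Import numFieldNormedType.Exports.
Local Open Scope classical_set_scope.
Local Open Scope ring_scope.

Section Copulas.
Variable R : realType.
Local Notation mu := (@lebesgue_measure R).

(* A bivariate copula, seen through its values on [0,1]^2 (values outside
   [0,1]^2 are irrelevant). *)
Definition is_copula (C : R -> R -> R) : Prop :=
  (forall u, 0 <= u <= 1 -> C u 0 = 0 /\ C 0 u = 0 /\ C u 1 = u /\ C 1 u = u) /\
  (forall u1 u2 v1 v2, 0 <= u1 -> u1 <= u2 -> u2 <= 1 ->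
       0 <= v1 -> v1 <= v2 -> v2 <= 1 ->
       0 <= C u2 v2 - C u2 v1 - C u1 v2 + C u1 v1).

(* partial derivative w.r.t. the first argument, where it exists (0 elsewhere;
   for copulas it exists almost everywhere). *)
Definition d1 (C : R -> R -> R) (u v : R) : R :=
  if pselect (derivable (fun t => C t v) u 1) then derive1 (fun t => C t v) u else 0.

Definition xi (C : R -> R -> R) : R :=
  6 * Rintegral mu `[0, 1] (fun v => Rintegral mu `[0, 1] (fun u => (d1 C u v) ^+ 2)) - 2.

Definition psi (C : R -> R -> R) : R :=
  6 * Rintegral mu `[0, 1] (fun u => C u u) - 2.

Definition is_SI (C : R -> R -> R) : Prop :=
  forall v, 0 <= v <= 1 ->
    exists N : set R, mu.-negligible N /\
      forall u1 u2, 0 <= u1 -> u1 <= u2 -> u2 <= 1 -> ~ N u1 -> ~ N u2 ->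
        d1 C u2 v <= d1 C u1 v.

Definition C_SI : set (R -> R -> R) := [set C | is_copula C /\ is_SI C].

Definition Pi (u v : R) : R := u * v.
Definition M (u v : R) : R := Num.min u v.

Definition frechet (a : R) (u v : R) : R := (1 - a) * u * v + a * Num.min u v.

Definition is_ordinal_sum (I : set nat) (a b : nat -> R)
    (Cs : nat -> R -> R -> R) (C : R -> R -> R) : Prop :=
  forall u v, 0 <= u <= 1 -> 0 <= v <= 1 ->
    (forall k, I k -> a k < u < b k -> a k < v < b k ->
       C u v = a k + (b k - a k) *
                 Cs k ((u - a k) / (b k - a k)) ((v - a k) / (b k - a k))) /\
    ((~ exists k, I k /\ a k < u < b k /\ a k < v < b k) -> C u v = M u v).

Definition ordinal_sum_data (I : set nat) (a b : nat -> R)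
    (Cs : nat -> R -> R -> R) : Prop :=
  (forall k, I k -> 0 <= a k /\ a k < b k /\ b k <= 1) /\
  (forall k l, I k -> I l -> k <> l -> `]a k, b k[ `&` `]a l, b l[ = set0) /\
  (forall k, I k -> is_copula (Cs k)).

Definition ordinal_sum_of_Pi (C : R -> R -> R) : Prop :=
  exists (I : set nat) (a b : nat -> R),
    ordinal_sum_data I a b (fun _ => Pi) /\ is_ordinal_sum I a b (fun _ => Pi) C.

Definition R_SI : set (R * R) := [set (xi C, psi C) | C in C_SI].

End Copulas.

(* Main.v *)
(* For a copula [C] and fixed [v], the section [C ^~ v] is nondecreasing and
   1-Lipschitz, hence has a density [g] with values in [0, 1] and [d1 C u v = g u]
   almost everywhere. Put [F v := \int g^2], so that [xi C = 6 \int F - 2]; it is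
   nondecreasing in [v], which settles measurability.

   Upper bound. For any [a], integrating over [u] the square of the difference of
   [g] and the density of [frechet a] gives
     [F v - 2 a C(v, v) + a^2 v - (1 - a)^2 v^2 >= 0],
   and integrating over [v] with [a = psi C] gives [psi C ^ 2 <= xi C]. Equality
   makes the left-hand side vanish for almost every [v], so [C] is [frechet a].

   Lower bound. If [C] is SI, [g] is nonincreasing; with [c] its value at [v],
   [\int_0^v g (1 - g) >= c (v - C(v, v)) >= \int_v^1 g^2], that is
   [F v <= C(v, v)], with equality for ordinal sums of [Pi].

   Mixing [M] with weight [a] and the ordinal sum of [Pi] on the block [(0, L)]
   gives [xi = 1 - L^2 (1 - a^2)] and [psi = 1 - L^2 (1 - a)], which sweeps out
   the whole region. *)

Require Import Defs.
From HB Require Import structures.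
From mathcomp Require Import all_boot all_order all_algebra.
From mathcomp Require Import all_classical all_reals all_analysis.
From mathcomp Require Import measurable_realfun ring lra.
Set Implicit Arguments. Unset Strict Implicit. Unset Printing Implicit Defensive.
Import Order.TTheory GRing.Theory Num.Theory.
Import numFieldNormedType.Exports.
Local Open Scope classical_set_scope.
Local Open Scope ring_scope.

Local Notation mu := (@lebesgue_measure _).

#[local] Instance lebesgue_ae_filter (R : realType) :
  Filter (nbhs (almost_everywhere (@lebesgue_measure R))).
Proof. exact: (ae_filter_ringOfSetsType (@lebesgue_measure R)). Qed.

(** * Densities of nondecreasing 1-Lipschitz functions *)

Lemma lebesgue_stieltjes_oc (R : realType) (f : cumulative R R) (a b : R) :
  a <= b -> lebesgue_stieltjes_measure f `]a, b] = (f b - f a)%:E.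
Proof.
move=> ab; rewrite /lebesgue_stieltjes_measure /measure_extension/=.
rewrite measurable_mu_extE/=; last exact: is_ocitv.
by rewrite wlength_itv_bnd.
Qed.

Lemma slope01_continuous (R : realType) (f : R -> R) :
  (forall x y, x <= y -> 0 <= f y - f x <= y - x) -> continuous f.
Proof.
move=> sf x; apply/(@cvgrPdist_le _ R^o) => e e0; near=> y.
apply: (@le_trans _ _ `|x - y|).
  have [xy|/ltW yx] := leP x y.
    by have /andP[] := sf _ _ xy; rewrite distrC (distrC x y) => ? ?;
       rewrite !ger0_norm// subr_ge0.
  by have /andP[] := sf _ _ yx => ? ?; rewrite !ger0_norm// subr_ge0.
by near: y; apply: cvgr_dist_le.
Unshelve. all: by end_near. Qed.

(** The Stieltjes measures of [f] and of [x - f x] add up to Lebesgue measure, by uniqueness on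
    half-open intervals, so the first is dominated by the sum. *)
Lemma slope01_stieltjes_le (R : realType) (f : R -> R) :
  (forall x y, x <= y -> 0 <= f y - f x <= y - x) ->
  exists2 nu : {measure set (measurableTypeR R) -> \bar R},
    (forall a b, a <= b -> nu `]a, b]%classic = (f b - f a)%:E) &
    (forall A, measurable A -> (nu A <= lebesgue_measure A)%E).
Proof.
move=> sf.
have sg : forall x y, x <= y -> 0 <= (y - f y) - (x - f x) <= y - x.
  by move=> x y /sf; lra.
pose g x := x - f x.
have ndf : nondecreasing_fun f by move=> x y /sf; lra.
have ndg : nondecreasing_fun g by move=> x y /sg; rewrite /g; lra.
have rcf := right_continuousW (slope01_continuous sf).
have rcg := right_continuousW (slope01_continuous sg).
pose mf := isCumulative.Build R _ R f ndf rcf.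
pose mg := isCumulative.Build R _ R g ndg rcg.
pose cf : cumulative R R := HB.pack f mf.
pose cg : cumulative R R := HB.pack g mg.
exists (lebesgue_stieltjes_measure cf).
  by move=> a b ab; exact: lebesgue_stieltjes_oc.
move=> A mA.
have -> : lebesgue_measure A = measure_add (lebesgue_stieltjes_measure cf)
    (lebesgue_stieltjes_measure cg) A; last by rewrite measure_addE leeDl.
apply: lebesgue_measure_unique => //.
move=> X [[a b] _ <-]; rewrite [RHS]measure_addE.
have [ab|ba] := leP a b; last first.
  by rewrite set_itv_ge ?measure0 ?adde0// bnd_simp -leNgt ltW.
transitivity ((f b - f a)%:E + (g b - g a)%:E)%E; last first.
  by congr (_ + _)%E; apply/esym; exact: lebesgue_stieltjes_oc.
rewrite [LHS]lebesgue_stieltjes_oc// -EFinD /g /=; congr EFin.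
by lra.
Qed.

(** Composing with [clamp01] extends a function constantly outside [[0, 1]], so that slope and
    monotonicity conditions hold on the whole line. *)
Definition clamp01 (R : realType) (x : R) : R := Num.max 0 (Num.min 1 x).

Lemma clamp01_bounds (R : realType) (x : R) : 0 <= clamp01 x <= 1.
Proof. by rewrite /clamp01 le_max lexx/= ge_max ler01 ge_min lexx. Qed.

Lemma clamp01_id (R : realType) (x : R) : 0 <= x <= 1 -> clamp01 x = x.
Proof. by move=> /andP[? ?]; rewrite /clamp01 min_r// max_r. Qed.

Lemma clamp01_slope (R : realType) (x y : R) :
  x <= y -> 0 <= clamp01 y - clamp01 x <= y - x.
Proof.
move=> xy; rewrite /clamp01; case: (leP 1 y) => ?; case: (leP 1 x) => ?;
  rewrite !maxEle; repeat case: ifPn; rewrite -?ltNge => *; lra.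
Qed.

Lemma clamp01_nondecreasing (R : realType) : nondecreasing_fun (@clamp01 R).
Proof. by move=> x y /clamp01_slope; lra. Qed.

Lemma ae_neq (R : realType) (a : R) : {ae @lebesgue_measure R, forall x : R, x != a}.
Proof.
exists [set a]; split => //; first exact: lebesgue_measure_set1.
by move=> x /= /negP; rewrite negbK => /eqP.
Qed.

Lemma nondecreasing_is_derive_ge0 (R : realType) (f : R -> R) (x d : R) :
  nondecreasing_fun f -> is_derive x 1 f d -> 0 <= d.
Proof.
move=> ndf [/cvg_ex[/= l fl] <-].
rewrite /derive (cvg_lim _ fl)//; apply: (cvgr_to_ge fl).
near=> h.
rewrite /= [h%:A]mulr1 /GRing.scale/=.
(* At [h = 0] the quotient is [0], because [0^-1 = 0]. *)
have [h0|h0|->] := ltgtP h 0; last by rewrite invr0 mul0r.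
- by rewrite nmulr_rge0 ?invr_lt0// subr_le0 ndf// gerDr ltW.
- by rewrite pmulr_rge0 ?invr_gt0// subr_ge0 ndf// lerDr ltW.
Unshelve. all: by end_near. Qed.

(* The Stieltjes measure of [f] is dominated by Lebesgue measure, so its
   Radon-Nikodym density is [f'] almost everywhere by Lebesgue differentiation. *)
Lemma slope01_density (R : realType) (f : R -> R) :
  (forall x y, x <= y -> 0 <= f y - f x <= y - x) ->
  exists g : R -> R, [/\ measurable_fun setT g,
    (forall x, 0 <= g x <= 1),
    (forall u, 0 <= u <= 1 ->
       Rintegral (@lebesgue_measure R) `[0, u] g = f u - f 0) &
    {ae @lebesgue_measure R, forall x : R, 0 < x < 1 -> is_derive x 1 f (g x)}].
Proof.
move=> sf; have [nu nuE nu_le] := slope01_stieltjes_le sf.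
have mI : measurable (`]0, 1]%classic : set (measurableTypeR R)) by [].
have nuoo : (nu `]0%R, 1%R]%classic < +oo)%E by rewrite nuE// ltry.
(* Restricting to []0, 1]] makes the measure finite, as Radon-Nikodym requires. *)
pose nu1 : {finite_measure set (measurableTypeR R) -> \bar R} := mfrestr mI nuoo.
have dom : nu1 `<< (mu : {sigma_finite_measure set (measurableTypeR R) -> \bar R}).
  apply/null_content_dominatesP => A mA A0; apply/eqP.
  rewrite eq_le measure_ge0 andbT /= /mfrestr /mrestr.
  rewrite -A0 (le_trans (nu_le _ _))//; first exact: measurableI.
  by rewrite le_measure ?inE//; exact: measurableI.
have [k [k0 kfin kint kE]] := radon_nikodym_sigma_finite dom.
pose g0 x := fine (k x).
have g0k : EFin \o g0 = k by apply/funext => x /=; rewrite fineK.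
have ig0 : mu.-integrable setT (EFin \o g0) by rewrite g0k.
have mg0 : measurable_fun setT g0 by apply/measurable_EFinP; exact: measurable_int ig0.
pose F y := Rintegral mu `[0, y] g0.
have FE y : 0 <= y <= 1 -> F y = f y - f 0.
  move=> /andP[y0 y1]; rewrite /F /Rintegral.
  under eq_integral do rewrite -[(g0 _)%:E]/((EFin \o g0) _) g0k.
  rewrite -kE//= /mfrestr /mrestr.
  rewrite (_ : _ `&` _ = `]0, y]%classic) ?nuE//.
  apply/seteqP; split => x /=; rewrite !in_itv/=; lra.
have aeF : {ae mu, forall x : R, 0 < x < 1 -> is_derive x 1 f (g0 x)}.
  have lg0 : locally_integrable setT g0.
    by apply: open_integrable_locally => //; exact: openT.
  have := @FTC1 R g0 (BLeft 0) (fun y => integrableS measurableT _ _ ig0) lg0.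
  move=> /(_ (fun y => measurable_itv _) (fun y => @subsetT _ _)).
  apply: filterS => x + /andP[x0 x1].
  rewrite lte_fin => /(_ x0)[dF F'].
  have /near_eq_is_derive : \near x, (F x + f 0) = f x.
    near=> z; rewrite FE ?subrK//.
    by apply/andP; split; apply: ltW; near: z; [exact: lt_nbhsr|exact: lt_nbhsl].
  apply; rewrite -[g0 x]addr0; apply: is_deriveD.
  by apply: DeriveDef; rewrite -?derive1E.
(* The density is only known to lie in [[0, 1]] almost everywhere, being a derivative there;
   clamping changes it on a null set and gives the bounds everywhere. *)
pose g x := clamp01 (g0 x).
have aeg : {ae mu, forall x : R, 0 < x < 1 -> g0 x = g x}.
  apply: filterS aeF => x + xI => /(_ xI) df.
  suff : 0 <= g0 x <= 1 by move=> ?; rewrite /g clamp01_id.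
  apply/andP; split.
    by apply: nondecreasing_is_derive_ge0 df => y z /sf; lra.
  rewrite -subr_ge0; apply: (@nondecreasing_is_derive_ge0 _ (fun t => t - f t) x).
    by move=> y z /sf; lra.
have mg : measurable_fun setT g.
  apply: measurableT_comp mg0.
  by apply: nondecreasing_measurable => //; exact: clamp01_nondecreasing.
exists g; split => //.
- by move=> x; exact: clamp01_bounds.
- move=> u /andP[u0 u1]; rewrite -FE ?u0// /F; congr fine.
  apply: ae_eq_integral => //.
  + by apply/measurable_EFinP; exact: measurable_funTS.
  + by apply/measurable_EFinP; exact: measurable_funTS.
  + apply: filterS3 (ae_neq 0) (ae_neq 1) aeg => x x0 x1 + /=.
    rewrite in_itv/= => + /andP[x0' x1'].
    by rewrite !lt_neqAle x0' (eq_sym 0) x0 x1 (le_trans x1' u1) => /(_ erefl) ->.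
- by apply: filterS2 aeF aeg => x + + xI => /(_ xI) + /(_ xI) <-.
Unshelve. all: by end_near. Qed.

(** * Almost everywhere equality and integrals of nonmeasurable functions *)

Import HBNNSimple.
(* [f] need not be measurable: its integral is the supremum over the simple
   functions below it, which only sees [f] up to a null set. *)
Lemma ge0_ae_eq_integral_nonmeas (d : measure_display) (T : measurableType d)
    (R : realType) (m : {measure set T -> \bar R}) (D : set T)
    (f g : T -> \bar R) :
  d.-measurable D -> measurable_fun D g ->
  (forall x, D x -> 0 <= f x)%E -> (forall x, D x -> 0 <= g x)%E ->
  ae_eq m D f g -> (\int[m]_(x in D) f x = \int[m]_(x in D) g x)%E.
Proof.
move=> mD mg f0 g0 [N [mN N0 fgN]].
have fgE x : D x -> ~ N x -> f x = g x.
  by move=> Dx Nx; apply: contrapT => fg; apply/Nx/fgN => /= /(_ Dx).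
apply/eqP; rewrite eq_le; apply/andP; split.
  rewrite ge0_integralE//; apply: ge_ereal_sup => _ [h /= hf <-].
  have -> : sintegral m h = (\int[m]_x (h x)%:E)%E.
    by rewrite integral_nnsfun// patch_setT.
  rewrite [leRHS]integral_mkcond; apply: ae_ge0_le_integral => //.
  - by move=> x _; rewrite lee_fin.
  - by apply/measurable_EFinP; exact: measurable_funPT.
  - by move=> x _; rewrite patchE; case: ifPn => // /set_mem /g0.
  - exact/(measurable_restrictT _ _).1.
  - exists N; split => // x /=; apply: contra_notP => Nx _.
    apply: (le_trans (hf x)); rewrite !patchE; case: ifPn => //.
    by rewrite inE => Dx; rewrite fgE.
(* Conversely, the integral of [g] is carried by [D] minus [N], where [g] is [f]. A simple function
   below [f] on that set and below [0] elsewhere is below [f] on all of [D], as [f >= 0]. *)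
rewrite (ge0_negligible_integral mN)//.
rewrite (@eq_integral _ _ _ m (D `\` N) f); last first.
  by move=> x; rewrite inE => -[Dx Nx]; rewrite fgE.
rewrite ge0_integralE; last by move=> x [/f0].
rewrite ge0_integralE//; apply: ereal_sup_le => _ [h /= hf <-]; exists h => //= x.
apply: (le_trans (hf x)).
rewrite !patchE; case: ifPn => [|_]; last by case: ifPn => // /set_mem /f0.
by rewrite inE => -[Dx Nx]; rewrite mem_set.
Qed.

(** * Densities of the sections of a copula *)

Lemma is_derive_d1 (R : realType) (C : R -> R -> R) (u v d : R) :
  is_derive u 1 (C ^~ v) d -> d1 C u v = d.
Proof.
move=> [du <-]; rewrite /d1; by case: pselect => //= _; exact: derive1E.
Qed.

Section copula.
Variables (R : realType) (C : R -> R -> R).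
Hypothesis copC : is_copula C.

Lemma copula_slope1 (u1 u2 v : R) : 0 <= u1 -> u1 <= u2 -> u2 <= 1 ->
  0 <= v <= 1 -> 0 <= C u2 v - C u1 v <= u2 - u1.
Proof.
move=> u10 u12 u21 /andP[v0 v1]; have [bd inc] := copC.
have U1 : 0 <= u1 <= 1 by lra.
have U2 : 0 <= u2 <= 1 by lra.
have [C10 [_ [C11 _]]] := bd _ U1; have [C20 [_ [C21 _]]] := bd _ U2.
have := inc _ _ _ _ u10 u12 u21 (lexx 0) v0 v1.
have := inc _ _ _ _ u10 u12 u21 v0 v1 (lexx 1).
by rewrite C10 C11 C20 C21; lra.
Qed.

Lemma copula_slope2 (u v1 v2 : R) : 0 <= v1 -> v1 <= v2 -> v2 <= 1 ->
  0 <= u <= 1 -> 0 <= C u v2 - C u v1 <= v2 - v1.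
Proof.
move=> v10 v12 v21 /andP[u0 u1]; have [bd inc] := copC.
have V1 : 0 <= v1 <= 1 by lra.
have V2 : 0 <= v2 <= 1 by lra.
have [_ [C10 [_ C11]]] := bd _ V1; have [_ [C20 [_ C21]]] := bd _ V2.
have := inc _ _ _ _ (lexx 0) u0 u1 v10 v12 v21.
have := inc _ _ _ _ u0 u1 (lexx 1) v10 v12 v21.
by rewrite C10 C11 C20 C21; lra.
Qed.

Lemma copula_density (v : R) : 0 <= v <= 1 ->
  exists g : R -> R, [/\ measurable_fun setT g,
    (forall x, 0 <= g x <= 1),
    (forall u, 0 <= u <= 1 -> Rintegral mu `[0, u] g = C u v) &
    {ae mu, forall x : R, 0 < x < 1 -> is_derive x 1 (C ^~ v) (g x)}].
Proof.
(* The values of [C] outside the unit square are unconstrained, so the section is replaced by its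
   constant extension. *)
move=> v01; pose f u := C (clamp01 u) v.
have sf x y : x <= y -> 0 <= f y - f x <= y - x.
  move=> xy; have /andP[? ?] := clamp01_bounds x.
  have /andP[? ?] := clamp01_bounds y; have := clamp01_slope xy => ?.
  have := @copula_slope1 (clamp01 x) (clamp01 y) v.
  by rewrite /f; lra.
have [g [mg g01 gE aeg]] := slope01_density sf.
exists g; split => //.
- move=> u u01; rewrite gE// /f !clamp01_id ?lexx ?ler01//.
  by have [/(_ v v01)[_ [-> _]] _] := copC; rewrite subr0.
- apply: filterS aeg => x + x01 => /(_ x01); apply: near_eq_is_derive.
  case/andP: x01 => x0 x1; near=> z; rewrite /f clamp01_id//.
  by apply/andP; split; apply: ltW; near: z; [exact: lt_nbhsr|exact: lt_nbhsl].
Unshelve. all: by end_near. Qed.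

Lemma ae_d1_eq (v : R) (g : R -> R) :
  {ae mu, forall x : R, 0 < x < 1 -> is_derive x 1 (C ^~ v) (g x)} ->
  {ae mu, forall x : R, 0 <= x <= 1 -> d1 C x v = g x}.
Proof.
apply: filterS3 (ae_neq 0) (ae_neq 1) => x x0 x1 + /andP[x0' x1'].
rewrite !lt_neqAle x0' (eq_sym 0) x0 x1 x1' => /(_ erefl).
exact: is_derive_d1.
Qed.

End copula.

(** The inner integral of [xi], denoted [F v] in the overview. *)
Definition sq_d1 (R : realType) (C : R -> R -> R) (v : R) : R :=
  Rintegral mu `[0, 1] (fun u => d1 C u v ^+ 2).

(** Measurability of [d1 C ^~ v] is not established, hence the transfer to a measurable density
    through [ge0_ae_eq_integral_nonmeas]. *)
Lemma sq_d1E (R : realType) (C : R -> R -> R) (v : R) (g : R -> R) :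
  measurable_fun setT g ->
  {ae mu, forall x : R, 0 <= x <= 1 -> d1 C x v = g x} ->
  sq_d1 C v = Rintegral mu `[0, 1] (fun u => g u ^+ 2).
Proof.
move=> mg aeg; congr fine; apply: ge0_ae_eq_integral_nonmeas => //.
- apply/measurable_EFinP/measurable_funX; exact: measurable_funTS.
- by move=> x _; rewrite lee_fin sqr_ge0.
- by move=> x _; rewrite lee_fin sqr_ge0.
- by apply: filterS aeg => x + /=; rewrite in_itv/= => + x01 => ->.
Qed.

(** * Integration tools on subintervals of [[0, 1]] *)

Lemma ae_ge0_le_Rintegral (d : measure_display) (T : measurableType d)
    (R : realType) (m : {measure set T -> \bar R}) (D : set T) (f g : T -> R) :
  d.-measurable D -> m.-integrable D (EFin \o f) -> m.-integrable D (EFin \o g) ->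
  (forall x, D x -> 0 <= f x) -> (forall x, D x -> 0 <= g x) ->
  {ae m, forall x, D x -> f x <= g x} ->
  Rintegral m D f <= Rintegral m D g.
Proof.
move=> mD intf intg f0 g0 fg; apply: fine_le; [exact: integrable_fin_num..|].
apply: ae_ge0_le_integral => //.
- exact: measurable_int intf.
- exact: measurable_int intg.
Qed.

Lemma Rintegral_sqrB (d : measure_display) (T : measurableType d)
    (R : realType) (m : {measure set T -> \bar R}) (D : set T) (g : T -> R) (k : R) :
  d.-measurable D -> (m D < +oo)%E ->
  m.-integrable D (EFin \o g) -> m.-integrable D (EFin \o (fun x => g x ^+ 2)) ->
  Rintegral m D (fun x => (g x - k) ^+ 2) =
  Rintegral m D (fun x => g x ^+ 2) - 2 * k * Rintegral m D g + k ^+ 2 * fine (m D).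
Proof.
move=> mD mDoo ig ig2.
have ic (c : R) : m.-integrable D (EFin \o (fun=> c)).
  by apply: measurable_bounded_integrable => //; exact: bounded_cst.
have ikg : m.-integrable D (EFin \o (fun x => (2 * k) * g x)).
  by apply: eq_integrable (integrableZl mD (2 * k) ig).
rewrite -Rintegral_cst// -RintegralZl// -RintegralB// -RintegralD//.
  by apply: eq_Rintegral => x _; ring.
by apply: eq_integrable (integrableB mD ig2 ikg).
Qed.

Lemma lebesgue_measure_bnd (R : realType) (a b : R) (x y : bool) : a <= b ->
  lebesgue_measure [set` Interval (BSide x a) (BSide y b)] = (b - a)%:E.
Proof.
move=> ab; rewrite lebesgue_measure_itv/= lte_fin lt_neqAle ab andbT EFinB.
by case: eqVneq => [->|//]; rewrite subee.
Qed.

Lemma lebesgue_measure_bnd_lty (R : realType) (a b : R) (x y : bool) :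
  (lebesgue_measure [set` Interval (BSide x a) (BSide y b)] < +oo)%E.
Proof.
rewrite lebesgue_measure_itv/= lte_fin.
by case: ifPn => //; rewrite -?EFinB ltry.
Qed.

Lemma itv01_integrable (R : realType) (i : interval R) (f : R -> R) :
  [set` i] `<=` `[0, 1] -> measurable_fun setT f -> (forall x, 0 <= f x <= 1) ->
  mu.-integrable [set` i] (EFin \o f).
Proof.
move=> iI mf f01; apply: (@integrableS _ _ _ mu `[0, 1]) => //.
apply: measurable_bounded_integrable => //.
- exact: (lebesgue_measure_bnd_lty _ _ true false).
- exact: measurable_funTS.
- exists 1; split => // M M1 x _; have /andP[f0 f1] := f01 x.
  by change (`|f x| <= M); rewrite ger0_norm// (le_trans f1)// ltW.
Qed.

Lemma Rintegral_itv01_split (R : realType) (f : R -> R) (v : R) :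
  0 <= v <= 1 -> mu.-integrable `[0, 1] (EFin \o f) ->
  Rintegral mu `[0, 1] f = Rintegral mu `[0, v] f + Rintegral mu `]v, 1] f.
Proof.
move=> /andP[v0 v1] intf; apply/eqP; rewrite addrC -subr_eq; apply/eqP.
by apply: Rintegral_itvB.
Qed.

(** Here [S], [I] and [l] stand for the integrals of [g^2], [g] and [1] over an interval. With
    [e = I - k * l], replacing [k] by [k + e] adds [(l - 2) e^2] to the quadratic, so the two bounds
    force [(2 - l) e^2 <= 0]. *)
Lemma sqrB_defect (R : realFieldType) (S I k l : R) : l <= 1 ->
  0 <= S - 2 * (k + (I - k * l)) * I + (k + (I - k * l)) ^+ 2 * l ->
  S - 2 * k * I + k ^+ 2 * l <= 0 -> I = k * l.
Proof.
move=> l1 h1 h2.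
have : (2 - l) * (I - k * l) ^+ 2 <= 0 by nra.
rewrite pmulr_rle0; last by lra.
by rewrite exprn_even_le0//= subr_eq0 => /eqP.
Qed.

(** * Square integrals of the density of a section *)

Section density.
Variables (R : realType) (C : R -> R -> R) (v : R) (g : R -> R).
Hypotheses (v01 : 0 <= v <= 1) (mg : measurable_fun setT g).
Hypothesis g01 : forall x, 0 <= g x <= 1.
Hypothesis C1v : C 1 v = v.
Hypothesis gE : forall u, 0 <= u <= 1 -> Rintegral mu `[0, u] g = C u v.

Let mg2 : measurable_fun setT (fun x => g x ^+ 2).
Proof. exact: measurable_funX. Qed.

Let g201 x : 0 <= g x ^+ 2 <= 1.
Proof. by have := g01 x; rewrite sqr_ge0/=; nra. Qed.

Lemma density_integral_oc (u : R) : 0 <= u <= 1 -> Rintegral mu `]u, 1] g = v - C u v.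
Proof.
move=> u01; have ig : mu.-integrable `[0, 1] (EFin \o g) by exact: itv01_integrable.
have := Rintegral_itv01_split u01 ig.
by rewrite !gE ?lexx ?ler01// C1v => ?; lra.
Qed.

Let subI (a b : R) (x y : bool) : 0 <= a -> b <= 1 ->
  [set` Interval (BSide x a) (BSide y b)] `<=` `[0, 1]%classic.
Proof.
by move=> a0 b1 z /=; rewrite !in_itv/=; move: x y => [] [] /=; lra.
Qed.

Let ig (a b : R) (x y : bool) : 0 <= a -> b <= 1 ->
  mu.-integrable [set` Interval (BSide x a) (BSide y b)] (EFin \o g).
Proof. by move=> a0 b1; apply: itv01_integrable => //; exact: subI. Qed.

Let ig2 (a b : R) (x y : bool) : 0 <= a -> b <= 1 ->
  mu.-integrable [set` Interval (BSide x a) (BSide y b)] (EFin \o (fun x => g x ^+ 2)).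
Proof. by move=> a0 b1; apply: itv01_integrable => //; exact: subI. Qed.

Lemma density_sqrB (a b k : R) (x y : bool) : 0 <= a -> a <= b -> b <= 1 ->
  let D := [set` Interval (BSide x a) (BSide y b)] in
  Rintegral mu D (fun x => (g x - k) ^+ 2) =
  Rintegral mu D (fun x => g x ^+ 2) - 2 * k * Rintegral mu D g + k ^+ 2 * (b - a).
Proof.
move=> a0 ab b1 D; rewrite Rintegral_sqrB//;
  [|exact: measurable_itv|exact: lebesgue_measure_bnd_lty|exact: ig|exact: ig2].
by rewrite [X in fine X]lebesgue_measure_bnd.
Qed.

Lemma density_deviation (k1 k2 : R) :
  Rintegral mu `[0, v] (fun x => (g x - k1) ^+ 2) +
  Rintegral mu `]v, 1] (fun x => (g x - k2) ^+ 2) =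
  Rintegral mu `[0, 1] (fun x => g x ^+ 2) - 2 * k1 * C v v - 2 * k2 * (v - C v v)
  + k1 ^+ 2 * v + k2 ^+ 2 * (1 - v).
Proof.
have /andP[v0 v1] := v01.
rewrite !density_sqrB// gE// density_integral_oc//.
by rewrite (Rintegral_itv01_split v01); [ring|exact: ig2].
Qed.

(* Perturbing [k] by the defect [e] of the claimed identity changes the
   integral of [(g - k)^2] by [(b - a - 2) e^2 <= 0]. *)
Lemma density_const (a b k : R) (x y : bool) : 0 <= a -> a <= b -> b <= 1 ->
  let D := [set` Interval (BSide x a) (BSide y b)] in
  Rintegral mu D (fun x => (g x - k) ^+ 2) <= 0 -> Rintegral mu D g = k * (b - a).
Proof.
move=> a0 ab b1 D.
have : 0 <= Rintegral mu D
    (fun x => (g x - (k + (Rintegral mu D g - k * (b - a)))) ^+ 2).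
  by apply: Rintegral_ge0 => z _; exact: sqr_ge0.
rewrite !density_sqrB//.
by move=> h1 h2; apply: sqrB_defect h1 h2; lra.
Qed.

Let igk (a b k : R) (x y : bool) : 0 <= a -> b <= 1 ->
  mu.-integrable [set` Interval (BSide x a) (BSide y b)]
    (EFin \o (fun x => (g x - k) ^+ 2)).
Proof.
move=> a0 b1; apply: measurable_bounded_integrable => //.
- exact: lebesgue_measure_bnd_lty.
- by apply: measurable_funX; apply: measurable_funB => //; exact: measurable_funTS.
- exists ((1 + `|k|) ^+ 2); split => // M' MM z _.
  change (`|(g z - k) ^+ 2| <= M').
  rewrite normrX (le_trans _ (ltW MM))// lerXn2r ?nnegrE ?addr_ge0//.
  rewrite (le_trans (ler_normB _ _))// lerD2r.
  by have /andP[? ?] := g01 z; rewrite ger0_norm.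
Qed.

(** Since the integrand is a square, its integral over [[0, u]] is at most the one over [[0, v]],
    and [density_const] applies on [[0, u]]. *)
Lemma density_left_const (k u : R) : 0 <= u <= v ->
  Rintegral mu `[0, v] (fun x => (g x - k) ^+ 2) <= 0 -> C u v = k * u.
Proof.
move=> /andP[u0 uv] le0; have /andP[v0 v1] := v01.
rewrite -gE ?u0 ?(le_trans uv)//; rewrite (@density_const _ _ k) ?subr0 ?(le_trans uv)//.
apply: le_trans le0; rewrite -subr_ge0 Rintegral_itvB ?bnd_simp//; last exact: igk.
by apply: Rintegral_ge0 => z _; exact: sqr_ge0.
Qed.

Lemma density_right_const (k u : R) : v <= u <= 1 ->
  Rintegral mu `]v, 1] (fun x => (g x - k) ^+ 2) <= 0 -> v - C u v = k * (1 - u).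
Proof.
move=> /andP[vu u1] le0; have /andP[v0 v1] := v01; have u0 := le_trans v0 vu.
rewrite -density_integral_oc ?u0// (@density_const _ _ k)//.
apply: le_trans le0; rewrite -(@Rintegral_itvB _ _ (BRight v) (BRight 1) u) ?bnd_simp//.
  rewrite gerBl; apply: Rintegral_ge0 => z _; exact: sqr_ge0.
exact: igk.
Qed.

(** Right of [v], [g <= c] gives [g^2 <= c g]. Left of [v], [(g - c) (1 - g) >= 0] gives
    [g^2 - c g + c <= g]. After integration the terms in [c] cancel, because [g] has integral
    [v - C v v] over []v, 1]]. *)
Lemma density_sqr_le (c : R) : 0 <= c <= 1 ->
  {ae mu, forall x : R, 0 <= x <= v -> c <= g x} ->
  {ae mu, forall x : R, v < x <= 1 -> g x <= c} ->
  Rintegral mu `[0, 1] (fun x => g x ^+ 2) <= C v v.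
Proof.
move=> c01 gec lec; have /andP[v0 v1] := v01.
rewrite (Rintegral_itv01_split v01); last exact: ig2.
have R2 : Rintegral mu `]v, 1] (fun x => g x ^+ 2) <= c * (v - C v v).
  rewrite -density_integral_oc// -RintegralZl//; last exact: ig.
  apply: ae_ge0_le_Rintegral => //.
  - exact: ig2.
  - by apply: eq_integrable (integrableZl _ c (ig _ _ _ _)).
  - by move=> x _; exact: sqr_ge0.
  - by move=> x _; have := g01 x; nra.
  - by apply: filterS lec => x + /=; rewrite in_itv/= => /[apply]; have := g01 x; nra.
have R1 : Rintegral mu `[0, v] (fun x => g x ^+ 2) - c * C v v + c * v <= C v v.
  have icg : mu.-integrable `[0, v] (EFin \o (fun x => c * g x)).
    by apply: eq_integrable (integrableZl _ c (ig _ _ _ _)).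
  have ic : mu.-integrable `[0, v] (EFin \o (fun x : R => c)).
    by apply: itv01_integrable => //; exact: subI.
  have igcg : mu.-integrable `[0, v] (EFin \o (fun x => g x ^+ 2 - c * g x)).
    by apply: eq_integrable (integrableB _ (ig2 _ _ _ _) icg).
  have <- : Rintegral mu `[0, v] (fun x => (g x ^+ 2 - c * g x) + c) =
      Rintegral mu `[0, v] (fun x => g x ^+ 2) - c * C v v + c * v.
    rewrite RintegralD// RintegralB//; last exact: ig2.
    rewrite RintegralZl// ?gE//; last exact: ig.
    by rewrite Rintegral_cst// [X in fine X]lebesgue_measure_bnd// subr0.
  rewrite -[leRHS]gE//; apply: ae_ge0_le_Rintegral => //.
  - by apply: eq_integrable (integrableD _ igcg ic).
  - exact: ig.
  - by move=> x _; have := g01 x; nra.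
  - by move=> x _; have := g01 x; lra.
  - by apply: filterS gec => x + /=; rewrite in_itv/= => /[apply]; have := g01 x; nra.
lra.
Qed.
End density.

(** * Quadratic, monotone and Lipschitz functions on [[0, 1]] *)

Lemma Rintegral_quadratic (R : realType) (a b p q r : R) : a <= b ->
  Rintegral mu `[a, b] (fun x => p * x ^+ 2 + q * x + r) =
  p / 3 * (b ^+ 3 - a ^+ 3) + q / 2 * (b ^+ 2 - a ^+ 2) + r * (b - a).
Proof.
rewrite le_eqVlt => /predU1P[->|ab].
  by rewrite set_itv1 Rintegral_set1 !subrr !mulr0 !addr0.
pose P : {poly R} := (p / 3) *: 'X^3 + (q / 2) *: 'X^2 + r *: 'X.
have PE x : P.[x] = p / 3 * x ^+ 3 + q / 2 * x ^+ 2 + r * x.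
  by rewrite /P !hornerE.
have P'E : horner P^`() = fun x => p * x ^+ 2 + q * x + r.
  apply/funext => x; rewrite /P !derivD !derivZ !derivXn derivX !hornerE/=.
  by field.
have cP x : {for x, continuous (horner P)} by exact: continuous_horner.
rewrite /Rintegral (@continuous_FTC2 _ _ (horner P))//=.
- by rewrite !PE; ring.
- by rewrite -P'E; apply: continuous_subspaceT => x; exact: continuous_horner.
- split => [x _||]; first exact: derivable_horner.
    by apply: cvg_at_right_filter; exact: cP.
  by apply: cvg_at_left_filter; exact: cP.
- by move=> x _; rewrite -derivE P'E.
Qed.

Lemma quadratic_integrable (R : realType) (a b p q r : R) :
  mu.-integrable `[a, b] (EFin \o (fun x => p * x ^+ 2 + q * x + r)).
Proof.
apply: continuous_compact_integrable; first exact: segment_compact.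
have -> : (fun x => p * x ^+ 2 + q * x + r) = horner (p *: 'X^2 + q *: 'X + r%:P).
  by apply/funext => x; rewrite !hornerE.
by apply: continuous_subspaceT => x; exact: continuous_horner.
Qed.

(** Monotonicity is the source of measurability both for [sq_d1 C] and for the diagonal of a
    copula. *)
Lemma nondecreasing01_integrable (R : realType) (f : R -> R) :
  (forall x y, 0 <= x -> x <= y -> y <= 1 -> f x <= f y) ->
  mu.-integrable `[0, 1] (EFin \o f).
Proof.
move=> ndf; pose h x := f (clamp01 x).
apply: (@eq_integrable _ _ _ mu _ _ (EFin \o h)) => //.
  by move=> x; rewrite inE/= in_itv/= => x01; rewrite /h clamp01_id.
apply: measurable_bounded_integrable => //.
- exact: (lebesgue_measure_bnd_lty _ _ true false).
- apply: nondecreasing_measurable => // x y xy; rewrite /h.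
  have := clamp01_nondecreasing xy; have := clamp01_bounds x.
  by have := clamp01_bounds y => ? ? ?; apply: ndf => //; lra.
- exists (`|f 0| + `|f 1|); split => // M' MM x _.
  change (`|h x| <= M'); apply: (le_trans _ (ltW MM)).
  have /andP[x0 x1] := clamp01_bounds x.
  have := ndf _ _ (lexx 0) x0 x1; have := ndf _ _ x0 x1 (lexx 1); rewrite -/(h x).
  have := ler_norm (f 1); have := ler_norm (- f 0); rewrite normrN.
  have := normr_ge0 (f 0); have := normr_ge0 (f 1).
  by rewrite ler_norml => *; lra.
Qed.

(** If [|f x| = e > 0], then [f] has no zero within [e / 2] of [x], and this neighbourhood meets
    [[0, 1]] in an interval of positive length. *)
Lemma lipschitz1_ae_eq0 (R : realType) (f : R -> R) :
  (forall x y, 0 <= x -> x <= y -> y <= 1 -> `|f y - f x| <= y - x) ->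
  {ae mu, forall x : R, 0 <= x <= 1 -> f x = 0} ->
  forall x, 0 <= x <= 1 -> f x = 0.
Proof.
move=> lf [B [mB B0 fB]] x /andP[x0 x1]; apply: contrapT => /eqP; rewrite -normr_gt0.
set e := `|f x| => e0.
pose a := Num.max 0 (x - e / 2); pose b := Num.min 1 (x + e / 2).
have ab : a < b by rewrite /a /b gt_max !lt_min; lra.
have : `[a, b] `<=` B.
  move=> y /=; rewrite in_itv/= ge_max le_min -!andbA => /and4P[y0 yd y1 yd'].
  apply: fB => /= fy0; have {}fy0 : f y = 0 by apply: fy0; rewrite y0.
  have [xy|/ltW yx] := leP x y.
    by have := lf _ _ x0 xy y1; rewrite fy0 sub0r normrN -/e; lra.
  by have := lf _ _ y0 yx x1; rewrite fy0 subr0 -/e; lra.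
move=> /(le_measure mu) /=.
rewrite !inE => /(_ (measurable_itv _) mB).
rewrite [X in (_ <= X)%E]B0 leNgt [X in (_ < X)%E]lebesgue_measure_bnd ?ltW//.
by rewrite lte_fin subr_gt0 ab.
Qed.

(** * Inequalities between [xi] and [psi], and the equality case *)

Section copula_inequalities.
Variables (R : realType) (C : R -> R -> R).
Hypothesis copC : is_copula C.

Lemma copula_1v (v : R) : 0 <= v <= 1 -> C 1 v = v.
Proof. by case: copC => + _ => /[apply] -[_ [_ []]]. Qed.

(** By the rectangle inequality, [C u w - C u v] is nondecreasing in [u], so the two densities
    satisfy [0 <= g <= h] almost everywhere. *)
Lemma sq_d1_nondecreasing (v w : R) : 0 <= v -> v <= w -> w <= 1 ->
  sq_d1 C v <= sq_d1 C w.
Proof.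
move=> v0 vw w1.
have v01 : 0 <= v <= 1 by rewrite v0 (le_trans vw).
have w01 : 0 <= w <= 1 by rewrite w1 (le_trans v0).
have [g [mg g01 gE dg]] := copula_density copC v01.
have [h [mh h01 hE dh]] := copula_density copC w01.
rewrite (sq_d1E mg (ae_d1_eq dg)) (sq_d1E mh (ae_d1_eq dh)).
apply: ae_ge0_le_Rintegral => //.
- apply: itv01_integrable => //; first exact: measurable_funX.
  by move=> x; have := g01 x; rewrite sqr_ge0/=; nra.
- apply: itv01_integrable => //; first exact: measurable_funX.
  by move=> x; have := h01 x; rewrite sqr_ge0/=; nra.
- by move=> x _; exact: sqr_ge0.
- by move=> x _; exact: sqr_ge0.
apply: filterS2 (filterI (ae_neq 0) (ae_neq 1)) (filterI dg dh).
move=> x [x0 x1] [dgx dhx] /=; rewrite in_itv/= => /andP[x0' x1'].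
have {x0 x0'}x0 : 0 < x by rewrite lt_neqAle eq_sym x0.
have {x1 x1'}x1 : x < 1 by rewrite lt_neqAle x1.
suff : g x <= h x by have := g01 x; nra.
rewrite -subr_ge0.
pose f t := C (clamp01 t) w - C (clamp01 t) v.
apply: (@nondecreasing_is_derive_ge0 _ f x).
  move=> s t st; have /andP[s0 s1] := clamp01_bounds s.
  have /andP[t0 t1] := clamp01_bounds t.
  have := clamp01_nondecreasing st => st'.
  by case: copC => _ /(_ _ _ _ _ s0 st' t1 v0 vw w1); rewrite /f; lra.
have := is_deriveB (dhx _) (dgx _); rewrite x0 x1 => /(_ erefl erefl).
apply: near_eq_is_derive; near=> z; rewrite /f !fctE clamp01_id//.
by apply/andP; split; apply: ltW; near: z; [exact: lt_nbhsr|exact: lt_nbhsl].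
Unshelve. all: by end_near. Qed.

Lemma sq_d1_le_diag (v : R) : is_SI C -> 0 <= v <= 1 -> sq_d1 C v <= C v v.
Proof.
move=> si v01.
have [g [mg g01 gE dg]] := copula_density copC v01.
rewrite (sq_d1E mg (ae_d1_eq dg)).
have [N [negN SI]] := si _ v01.
(* The good points: outside the exceptional set of [is_SI], with [g] equal to the partial
   derivative. On them [g] is nonincreasing. *)
pose P x := ~ N x /\ (0 <= x <= 1 -> d1 C x v = g x).
have aeP : {ae mu, forall x, P x}.
  apply: filterI (ae_d1_eq dg).
  by case: negN => B [mB B0 NB]; exists B; split => // x /= /contrapT /NB.
have Pg x y : P x -> P y -> 0 <= x -> x <= y -> y <= 1 -> g y <= g x.
  move=> [Nx dx] [Ny dy] x0 xy y1.
  rewrite -dx ?x0 ?(le_trans xy)// -dy ?y1 ?(le_trans x0)//.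
  exact: SI.
(* The threshold [c] is the supremum of [g] over the good points right of [v]; adding [0] keeps the
   set nonempty when [v = 1] and makes [c] nonnegative. *)
pose S := [set 0] `|` [set g x | x in [set x | P x /\ v < x <= 1]].
have ubS : ubound S 1 by move=> _ [->|[x _ <-]]; [exact: ler01|have := g01 x; lra].
have hubS : has_ubound S by exists 1.
have /andP[v0 v1] := v01.
apply: (density_sqr_le v01 mg g01 (copula_1v v01) gE (c := sup S)).
- apply/andP; split; first by apply: ub_le_sup => //; left.
  by apply: ge_sup => //; exists 0; left.
- apply: filterS aeP => x Px /andP[x0 xv]; apply: ge_sup; first by exists 0; left.
  move=> _ [->|[y [Py /andP[vy y1]] <-]]; first by have := g01 x; lra.
  by apply: Pg => //; rewrite (le_trans xv)// ltW.
- by apply: filterS aeP => x Px vx1; apply: ub_le_sup => //; right; exists x.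
Qed.

(* The integral over [u] of the squared distance between [u |-> d1 C u v] and
   the first derivative of [frechet a], written through [sq_d1] and the diagonal. *)
Definition deviation (a v : R) : R :=
  sq_d1 C v - 2 * a * C v v + a ^+ 2 * v - (1 - a) ^+ 2 * v ^+ 2.

(** The constants [(1 - a) * v + a] and [(1 - a) * v] are the slopes of the section of [frechet a]
    at height [v], left and right of [u = v]. *)
Lemma deviationE (a v : R) : 0 <= v <= 1 -> exists g : R -> R,
  [/\ measurable_fun setT g, forall x, 0 <= g x <= 1,
      forall u, 0 <= u <= 1 -> Rintegral mu `[0, u] g = C u v &
      deviation a v =
      Rintegral mu `[0, v] (fun x => (g x - ((1 - a) * v + a)) ^+ 2) +
      Rintegral mu `]v, 1] (fun x => (g x - (1 - a) * v) ^+ 2)].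
Proof.
move=> v01; have [g [mg g01 gE dg]] := copula_density copC v01.
exists g; split => //.
rewrite (density_deviation v01 mg g01 (copula_1v v01) gE).
by rewrite /deviation (sq_d1E mg (ae_d1_eq dg)); ring.
Qed.

Lemma deviation_ge0 (a v : R) : 0 <= v <= 1 -> 0 <= deviation a v.
Proof.
move=> /(deviationE a)[g [_ _ _ ->]].
by apply: addr_ge0; apply: Rintegral_ge0 => x _; exact: sqr_ge0.
Qed.

(** Both square integrals vanish, so the section is affine on each side of [v], anchored at
    [C 0 v = 0] and [C 1 v = v]. *)
Lemma deviation_eq0 (a u v : R) : 0 <= u <= 1 -> 0 <= v <= 1 ->
  deviation a v = 0 -> C u v = frechet a u v.
Proof.
move=> /andP[u0 u1] v01 /eqP; have [g [mg g01 gE ->]] := deviationE a v01.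
rewrite paddr_eq0; try by apply: Rintegral_ge0 => x _; exact: sqr_ge0.
move=> /andP[/eqP l0 /eqP r0].
rewrite /frechet; have [uv|/ltW vu] := leP u v.
  rewrite (density_left_const v01 mg g01 gE (k := (1 - a) * v + a)) ?u0 ?l0//.
  by ring.
have := density_right_const v01 mg g01 (copula_1v v01) gE (k := (1 - a) * v) (u := u).
by rewrite vu u1 r0 lexx => /(_ erefl erefl) E; lra.
Qed.

Let isq : mu.-integrable `[0, 1] (EFin \o sq_d1 C).
Proof. by apply: nondecreasing01_integrable; exact: sq_d1_nondecreasing. Qed.

Lemma diag_integrable : mu.-integrable `[0, 1] (EFin \o (fun v => C v v)).
Proof.
apply: nondecreasing01_integrable => x y x0 xy y1.
have y01 : 0 <= y <= 1 by rewrite y1 (le_trans x0).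
have x01 : 0 <= x <= 1 by rewrite x0 (le_trans xy).
have := copula_slope1 copC x0 xy y1 y01.
by have := copula_slope2 copC x0 xy y1 x01; lra.
Qed.

Lemma copula_diag_bounds (v : R) : 0 <= v <= 1 -> 0 <= C v v <= v.
Proof.
move=> /[dup] v01 /andP[v0 v1].
have [/(_ v v01) [C0 [_ [C1 _]]] _] := copC.
have := copula_slope2 copC (lexx 0) v0 v1 v01.
by have := copula_slope2 copC v0 v1 (lexx 1) v01; rewrite C0 C1; lra.
Qed.

Lemma deviation_integrable (a : R) :
  mu.-integrable `[0, 1] (EFin \o deviation a).
Proof.
have i1 : mu.-integrable `[0, 1] (EFin \o (fun v => 2 * a * C v v)).
  by apply: eq_integrable (integrableZl _ (2 * a) diag_integrable).
have i2 : mu.-integrable `[0, 1] (EFin \o (fun v => sq_d1 C v - 2 * a * C v v)).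
  by apply: eq_integrable (integrableB _ isq i1).
apply: eq_integrable (integrableD _ i2
  (quadratic_integrable 0 1 (- (1 - a) ^+ 2) (a ^+ 2) 0)) => //.
by move=> v _ /=; rewrite -EFinD; congr EFin; rewrite /deviation; ring.
Qed.

(** As a quadratic in [a] this is smallest at [a = psi C], with value [(xi C - psi C ^ 2) / 6]; its
    nonnegativity there is the upper bound. *)
Lemma Rintegral_deviation (a : R) : Rintegral mu `[0, 1] (deviation a) =
  (xi C - 2 * a * psi C + a ^+ 2) / 6.
Proof.
have i1 : mu.-integrable `[0, 1] (EFin \o (fun v => 2 * a * C v v)).
  by apply: eq_integrable (integrableZl _ (2 * a) diag_integrable).
have i2 : mu.-integrable `[0, 1] (EFin \o (fun v => sq_d1 C v - 2 * a * C v v)).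
  by apply: eq_integrable (integrableB _ isq i1).
transitivity (Rintegral mu `[0, 1] (fun v => (sq_d1 C v - 2 * a * C v v) +
  (- (1 - a) ^+ 2 * v ^+ 2 + a ^+ 2 * v + 0))).
  by apply: eq_Rintegral => v _; rewrite /deviation; ring.
rewrite RintegralD//; last exact: quadratic_integrable.
rewrite RintegralB// RintegralZl//; last exact: diag_integrable.
rewrite Rintegral_quadratic ?ler01// /xi /psi -/(sq_d1 _ _).
by rewrite -[X in 6 * X - 2]/(Rintegral mu `[0, 1] (sq_d1 C)); field.
Qed.

Lemma psi_sqr_le_xi : psi C ^+ 2 <= xi C.
Proof.
have : 0 <= Rintegral mu `[0, 1] (deviation (psi C)).
  by apply: Rintegral_ge0 => v /=; rewrite in_itv/=; exact: deviation_ge0.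
by rewrite Rintegral_deviation; nra.
Qed.

Lemma psi_le1 : psi C <= 1.
Proof.
have : Rintegral mu `[0, 1] (fun v => C v v) <=
    Rintegral mu `[0, 1] (fun v => 0 * v ^+ 2 + 1 * v + 0).
  apply: le_Rintegral => //; [exact: diag_integrable|exact: quadratic_integrable|].
  by move=> v; rewrite /= in_itv/= => /copula_diag_bounds; lra.
by rewrite Rintegral_quadratic// /psi; lra.
Qed.

Lemma xi_le_psi : is_SI C -> xi C <= psi C.
Proof.
move=> si; suff : Rintegral mu `[0, 1] (sq_d1 C) <= Rintegral mu `[0, 1] (fun v => C v v).
  by rewrite /xi /psi /sq_d1; lra.
apply: le_Rintegral => //; first exact: diag_integrable.
by move=> v; rewrite /= in_itv/= => v01; exact: sq_d1_le_diag.
Qed.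

(** The nonnegative function [deviation a] has integral zero, which gives the equality for almost
    every [v]. Both sides have increments in [v] between [0] and [y - x], so their difference is
    1-Lipschitz and vanishes everywhere. *)
Lemma xi_psi_frechet (a u v : R) : 0 <= a <= 1 -> xi C = a ^+ 2 -> psi C = a ->
  0 <= u <= 1 -> 0 <= v <= 1 -> C u v = frechet a u v.
Proof.
move=> a01 xiE psiE u01 v01.
have int0 : (\int[mu]_(x in `[0%R, 1%R]) `|(EFin \o deviation a) x|)%E = 0.
  have := Rintegral_deviation a; rewrite xiE psiE.
  rewrite (_ : (_ - _ + _) / 6 = 0); last by field.
  rewrite /Rintegral => F0; under eq_integral.
    move=> x; rewrite inE/= in_itv/= => x01.
    by rewrite ger0_norm ?deviation_ge0//; over.
  by rewrite -[LHS]fineK ?F0//; exact: (integrable_fin_num _ (deviation_integrable a)).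
have aeC : {ae mu, forall w : R, 0 <= w <= 1 -> C u w - frechet a u w = 0}.
  have [+ _] := ae_eq_integral_abs mu (measurable_itv `[0%R, 1%R])
    (measurable_int _ (deviation_integrable a)).
  move=> /(_ int0); apply: filterS => w + w01 => /(_ w01) [dw0].
  by rewrite (deviation_eq0 (a := a))// subrr.
apply/eqP; rewrite -subr_eq0; apply/eqP.
apply: (lipschitz1_ae_eq0 _ aeC v01) => x y x0 xy y1.
have := copula_slope2 copC x0 xy y1 u01.
have : 0 <= frechet a u y - frechet a u x <= y - x.
  have -> : frechet a u y - frechet a u x =
    (1 - a) * (u * (y - x)) + a * (Num.min u y - Num.min u x).
    by rewrite /frechet; ring.
  have : 0 <= Num.min u y - Num.min u x <= y - x.
    by case: (leP u x) => ?; case: (leP u y) => ?; lra.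
  have : 0 <= u * (y - x) <= y - x by nra.
  by nra.
by rewrite ler_norml; lra.
Qed.

End copula_inequalities.

(** * Sections that are concave and affine on three pieces *)

Lemma affine_near_d1 (R : realType) (C : R -> R -> R) (v a b c s x : R) :
  (forall u, a < u < b -> C u v = c + s * u) -> a < x < b -> d1 C x v = s.
Proof.
move=> CE /andP[ax xb]; apply: is_derive_d1.
have : is_derive x 1 (cst c + s *: id : R -> R) (0 + s *: 1) by exact: is_deriveD.
rewrite add0r /GRing.scale/= mulr1; apply: near_eq_is_derive.
near=> z; rewrite CE//.
by apply/andP; split; near: z; [exact: lt_nbhsr|exact: lt_nbhsl].
Unshelve. all: by end_near. Qed.

Section concave_piecewise_affine.
Variables (R : realType) (C : R -> R -> R) (v p q : R) (c1 c2 c3 s1 s2 s3 : R).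
Hypotheses (p0 : 0 <= p) (pq : p <= q) (q1 : q <= 1).
Hypotheses (s12 : s2 <= s1) (s23 : s3 <= s2).
Hypothesis C1E : forall u, 0 < u < p -> C u v = c1 + s1 * u.
Hypothesis C2E : forall u, p < u < q -> C u v = c2 + s2 * u.
Hypothesis C3E : forall u, q < u < 1 -> C u v = c3 + s3 * u.

Let g x := if x <= p then s1 else if x <= q then s2 else s3.

Let g_nonincreasing x y : x <= y -> g y <= g x.
Proof. move=> xy; move: s12 s23 pq; rewrite /g.
by case: (leP x p) => ?; case: (leP x q) => ?; case: (leP y p) => ?;
  case: (leP y q) => ? *; lra. Qed.

Let ae_d1g : {ae mu, forall x : R, 0 <= x <= 1 -> d1 C x v = g x}.
Proof.
apply: filterS2 (filterI (ae_neq 0) (ae_neq 1)) (filterI (ae_neq p) (ae_neq q)).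
move=> x [x0 x1] [xp xq]; rewrite !le_eqVlt (eq_sym 0) (negbTE x0) (negbTE x1)/=.
move=> /andP[{}x0 {}x1]; rewrite /g !le_eqVlt (negbTE xp) (negbTE xq)/=.
case: ltP => [xltp|]; first by apply: (affine_near_d1 C1E); rewrite x0.
rewrite le_eqVlt eq_sym (negbTE xp)/= => px.
case: ltP => [xltq|]; first by apply: (affine_near_d1 C2E); rewrite px.
rewrite le_eqVlt eq_sym (negbTE xq)/= => qx.
by apply: (affine_near_d1 C3E); rewrite qx.
Qed.

Lemma sq_d1_piecewise_affine :
  sq_d1 C v = s1 ^+ 2 * p + s2 ^+ 2 * (q - p) + s3 ^+ 2 * (1 - q).
Proof.
have mg : measurable_fun setT g.
  by apply: nonincreasing_measurable => // x y xy; exact: g_nonincreasing.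
rewrite (sq_d1E mg ae_d1g).
have ig2 (i : interval R) : [set` i] `<=` `[0, 1]%classic ->
    mu.-integrable [set` i] (EFin \o (fun x => g x ^+ 2)).
  move=> iI; apply: (@integrableS _ _ _ mu `[0, 1]) => //.
  apply: measurable_bounded_integrable => //.
  - exact: (lebesgue_measure_bnd_lty _ _ true false).
  - by apply: measurable_funX; exact: measurable_funTS.
  - exists (s1 ^+ 2 + s2 ^+ 2 + s3 ^+ 2); split; first exact: num_real.
    move=> M' MM z _.
    change (`|g z ^+ 2| <= M'); rewrite ger0_norm ?sqr_ge0//.
    apply: le_trans (ltW MM); rewrite /g.
    have := sqr_ge0 s1; have := sqr_ge0 s2; have := sqr_ge0 s3.
    by case: ifP => _; last case: ifP => _; lra.
have I1 : Rintegral mu `[0, p] (fun x => g x ^+ 2) = s1 ^+ 2 * p.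
  rewrite (@eq_Rintegral _ _ _ _ _ (fun=> s1 ^+ 2)).
    by rewrite Rintegral_cst// [X in fine X]lebesgue_measure_bnd// subr0.
  by move=> x; rewrite inE/= in_itv/= => /andP[_ xp]; rewrite /g xp.
have I2 : Rintegral mu `]p, q] (fun x => g x ^+ 2) = s2 ^+ 2 * (q - p).
  rewrite (@eq_Rintegral _ _ _ _ _ (fun=> s2 ^+ 2)).
    by rewrite Rintegral_cst// [X in fine X]lebesgue_measure_bnd.
  by move=> x; rewrite inE/= in_itv/= => /andP[px xq]; rewrite /g xq leNgt px.
have I3 : Rintegral mu `]q, 1] (fun x => g x ^+ 2) = s3 ^+ 2 * (1 - q).
  rewrite (@eq_Rintegral _ _ _ _ _ (fun=> s3 ^+ 2)).
    by rewrite Rintegral_cst// [X in fine X]lebesgue_measure_bnd.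
  move=> x; rewrite inE/= in_itv/= => /andP[qx _]; rewrite /g !leNgt qx.
  by rewrite (le_lt_trans pq).
rewrite (@Rintegral_itv01_split _ _ p); last 2 first.
- by rewrite p0 (le_trans pq).
- exact: ig2.
have := @Rintegral_itvB _ (fun x => g x ^+ 2) (BRight p) (BRight 1) q.
rewrite I1 I2 I3 !bnd_simp => /(_ _ pq q1) E.
rewrite -addrA -E; first by ring.
by apply: ig2 => x /=; rewrite !in_itv/=; move: p0; lra.
Qed.

Lemma SI_piecewise_affine : exists N : set R, mu.-negligible N /\
  forall u1 u2, 0 <= u1 -> u1 <= u2 -> u2 <= 1 -> ~ N u1 -> ~ N u2 ->
    d1 C u2 v <= d1 C u1 v.
Proof.
exists (~` [set x | 0 <= x <= 1 -> d1 C x v = g x]); split; first exact: ae_d1g.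
move=> x y x0 xy y1 /contrapT Nx /contrapT Ny.
by rewrite Nx ?Ny ?g_nonincreasing// ?x0 ?y1 ?(le_trans x0)// (le_trans xy).
Qed.

End concave_piecewise_affine.

(** * The two-parameter family filling the region *)

(* The mixture, with weight [a] on [M], of [M] and the ordinal sum of [Pi] with
   the single block [(0, L)]; since [x / 0 = 0], taking [L = 0] gives [M]. *)
Definition block_copula (R : realType) (L a u v : R) : R :=
  a * Num.min u v + (1 - a) * (Num.min u L * Num.min v L / L +
    Num.min (Num.max (u - L) 0) (Num.max (v - L) 0)).

Lemma block_copulaC (R : realType) (L a u v : R) :
  block_copula L a u v = block_copula L a v u.
Proof.
rewrite /block_copula (minC u v) (minC (Num.max (u - L) 0)).
by rewrite (mulrC (Num.min u L)).
Qed.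

Lemma block_copula_lt (R : realType) (L a u v : R) : 0 <= u -> 0 <= v < L ->
  block_copula L a u v = a * Num.min u v + (1 - a) * (Num.min u L * v / L).
Proof.
move=> u0 /andP[v0 vL]; rewrite /block_copula (min_l (ltW vL)).
rewrite (max_r (_ : v - L <= 0)); last by lra.
by rewrite (min_r (_ : 0 <= Num.max (u - L) 0)) ?addr0// le_max lexx orbT.
Qed.

(** At height [v >= L] the ordinal sum itself agrees with [M], so the weight [a] disappears. *)
Lemma block_copula_ge (R : realType) (L a u v : R) : 0 <= u -> L <= v ->
  block_copula L a u v = Num.min u v.
Proof.
move=> u0 Lv; rewrite /block_copula (min_r Lv) (max_l (_ : 0 <= v - L)) ?subr_ge0//.
suff -> : Num.min u L * L / L + Num.min (Num.max (u - L) 0) (v - L) = Num.min u v.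
  by ring.
have [L0|L0] := eqVneq L 0.
  by rewrite L0 invr0 mulr0 add0r !subr0 max_l.
rewrite mulfK//; have [uL|/ltW Lu] := leP u L.
  rewrite (min_l (le_trans uL Lv)) max_r ?subr_le0//.
  by rewrite min_l ?addr0 ?subr_ge0.
rewrite max_l ?subr_ge0//.
by have [uv|/ltW vu] := leP u v; [rewrite min_l|rewrite min_r]; lra.
Qed.

Section block_copula.
Variables (R : realType) (L a : R) (C : R -> R -> R).
Hypotheses (L01 : 0 <= L <= 1) (a01 : 0 <= a <= 1).
Hypothesis CE : forall u v, 0 <= u <= 1 -> 0 <= v <= 1 -> C u v = block_copula L a u v.

(** The rectangle inequality holds for each term: for [min], for a product of nondecreasing
    functions of [u] and of [v], and for [min] of nondecreasing functions. The weights [a] and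
    [1 - a] are nonnegative. *)
Lemma is_copula_block : is_copula C.
Proof.
have /andP[L0 L1] := L01; have /andP[a0 a1] := a01.
have zero u : 0 <= u <= 1 -> C u 0 = 0 /\ C u 1 = u.
  move=> /[dup] u01 /andP[u0 u1]; rewrite !CE ?lexx ?ler01//; split.
    have [L0'|L0'] := ltP 0 L.
      by rewrite block_copula_lt ?lexx// min_r// !(mulr0,mul0r) addr0.
    by rewrite block_copula_ge// min_r.
  by rewrite block_copula_ge// min_l.
split=> [u u01|u1 u2 v1 v2 u10 u12 u21 v10 v12 v21].
  have [C0 C1] := zero u u01.
  have sym w : 0 <= w <= 1 -> C w u = C u w by move=> w01; rewrite !CE// block_copulaC.
  by rewrite !sym ?lexx ?ler01.
have min_incr (x1 x2 y1 y2 : R) : x1 <= x2 -> y1 <= y2 ->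
    0 <= Num.min x2 y2 - Num.min x2 y1 - Num.min x1 y2 + Num.min x1 y1.
  by move=> x12 y12; case: (leP x2 y2) => ?; case: (leP x2 y1) => ?;
    case: (leP x1 y2) => ?; case: (leP x1 y1) => ?; lra.
have min_mono (x y : R) : x <= y -> Num.min x L <= Num.min y L.
  by move=> xy; case: (leP x L) => ?; case: (leP y L) => ?; lra.
have max_mono (x y : R) : x <= y -> Num.max (x - L) 0 <= Num.max (y - L) 0.
  by move=> xy; case: (leP (x - L) 0) => ?; case: (leP (y - L) 0) => ?; lra.
rewrite !CE; try by apply/andP; lra.
rewrite /block_copula.
have hM := min_incr _ _ _ _ u12 v12.
have hQ := min_incr _ _ _ _ (max_mono _ _ u12) (max_mono _ _ v12).
have hP : 0 <= (Num.min u2 L - Num.min u1 L) * (Num.min v2 L - Num.min v1 L) / L.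
  by rewrite divr_ge0// mulr_ge0// subr_ge0 min_mono.
have a1' : 0 <= 1 - a by rewrite subr_ge0.
apply: le_trans (addr_ge0 (mulr_ge0 a0 hM) (mulr_ge0 a1' (addr_ge0 hP hQ))) _.
by rewrite le_eqVlt; apply/orP; left; apply/eqP; ring.
Qed.

(* The square derivative integrates to the diagonal section of the block copula
   with [a] replaced by [a ^+ 2], which turns [psi] into [xi]. *)
Lemma sq_d1_block (v : R) : 0 <= v <= 1 ->
  sq_d1 C v = block_copula L (a ^+ 2) v v /\
  exists N : set R, mu.-negligible N /\
  forall u1 u2, 0 <= u1 -> u1 <= u2 -> u2 <= 1 -> ~ N u1 -> ~ N u2 ->
    d1 C u2 v <= d1 C u1 v.
Proof.
have /andP[L0 L1] := L01; have /andP[a0 a1] := a01.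
move=> /[dup] v01 /andP[v0 v1]; have [vL|Lv] := ltP v L.
  have Lgt0 : 0 < L by exact: le_lt_trans vL.
  (* The section has slope [a + s] up to [v], then [s] up to [L], then [0]. *)
  pose s := (1 - a) * v / L.
  have s0 : 0 <= s by rewrite divr_ge0// mulr_ge0// subr_ge0.
  have E1 u : 0 < u < v -> C u v = 0 + (a + s) * u.
    move=> /andP[u0 uv]; rewrite CE//; last by apply/andP; lra.
    rewrite block_copula_lt ?v0 ?ltW// (min_l (ltW uv)) min_l; last by lra.
    by rewrite /s; ring.
  have E2 u : v < u < L -> C u v = a * v + s * u.
    move=> /andP[vu uL]; rewrite CE//; last by apply/andP; lra.
    rewrite block_copula_lt ?v0 ?(le_trans v0) ?ltW// (min_r (ltW vu)) min_l ?ltW//.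
    by rewrite /s; ring.
  have E3 u : L < u < 1 -> C u v = v + 0 * u.
    move=> /andP[Lu u1]; rewrite CE//; last by apply/andP; lra.
    rewrite block_copula_lt ?v0; try by lra.
    rewrite (min_r (_ : v <= u)) ?(min_r (ltW Lu)); last by lra.
    by field; rewrite gt_eqF.
  split; last first.
    by apply: (SI_piecewise_affine (ltW vL) _ s0 E1 E2 E3); lra.
  rewrite (sq_d1_piecewise_affine v0 (ltW vL) L1 _ s0 E1 E2 E3); last by lra.
  rewrite block_copula_lt ?v0// minxx (min_l (ltW vL)) /s.
  by field; rewrite gt_eqF.
have E1 u : 0 < u < v -> C u v = 0 + 1 * u.
  move=> /andP[u0 uv]; rewrite CE//; last by apply/andP; lra.
  by rewrite block_copula_ge ?(ltW u0)// (min_l (ltW uv)); ring.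
(* The section of [M] has two pieces only: the middle one is empty, and its slope [0] just respects
   the ordering of the slopes. *)
have E2 u : v < u < v -> C u v = 0 + 0 * u by lra.
have E3 u : v < u < 1 -> C u v = v + 0 * u.
  move=> /andP[vu u1]; rewrite CE//; last by apply/andP; lra.
  by rewrite block_copula_ge ?(le_trans v0 (ltW vu))// (min_r (ltW vu)); ring.
split; last exact: (SI_piecewise_affine (lexx v) ler01 (lexx 0) E1 E2 E3).
rewrite (sq_d1_piecewise_affine v0 (lexx v) v1 ler01 (lexx 0) E1 E2 E3).
by rewrite block_copula_ge// minxx; ring.
Qed.

Lemma block_C_SI : C_SI C.
Proof. by split; [exact: is_copula_block|move=> v /sq_d1_block[]]. Qed.

End block_copula.

(** Stated with the normalisation common to [xi] and [psi]: [psi_block] uses it at [a] and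
    [xi_block] at [a ^+ 2]. *)
Lemma Rintegral_block_diag (R : realType) (L a : R) : 0 <= L <= 1 -> 0 <= a <= 1 ->
  6 * Rintegral mu `[0, 1] (fun v => block_copula L a v v) - 2 = 1 - L ^+ 2 * (1 - a).
Proof.
move=> /[dup] L01 /andP[L0 L1] a01.
have il : Rintegral mu `[0, L] (fun v => block_copula L a v v) =
    Rintegral mu `[0, L] (fun v => (1 - a) / L * v ^+ 2 + a * v + 0).
  apply: eq_Rintegral => v; rewrite inE/= in_itv/= => /andP[v0].
  rewrite le_eqVlt => /predU1P[->|vL].
    rewrite block_copula_ge// minxx.
    have [->|Ln0] := eqVneq L 0; first by ring.
    by field.
  by rewrite block_copula_lt ?v0// minxx (min_l (ltW vL)); ring.
have ir : Rintegral mu `]L, 1] (fun v => block_copula L a v v) =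
    Rintegral mu `]L, 1] (fun v => 0 * v ^+ 2 + 1 * v + 0).
  apply: eq_Rintegral => v; rewrite inE/= in_itv/= => /andP[Lv v1].
  by rewrite block_copula_ge// ?minxx; [ring|rewrite (le_trans L0)// ltW|exact: ltW].
rewrite (@Rintegral_itv01_split _ _ L)//.
  rewrite il ir Rintegral_itv_obnd_cbnd; last first.
    by apply: integrableS (quadratic_integrable L 1 _ _ _) => //; exact: subset_itv_oc_cc.
  rewrite !Rintegral_quadratic//.
  have [->|Ln0] := eqVneq L 0; first by rewrite invr0; lra.
  by field.
by apply: diag_integrable; exact: (is_copula_block L01 a01).
Qed.

Lemma psi_block (R : realType) (L a : R) (C : R -> R -> R) :
  0 <= L <= 1 -> 0 <= a <= 1 ->
  (forall u v, 0 <= u <= 1 -> 0 <= v <= 1 -> C u v = block_copula L a u v) ->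
  psi C = 1 - L ^+ 2 * (1 - a).
Proof.
move=> L01 a01 CE; rewrite -Rintegral_block_diag// /psi; congr (_ * _ - _).
by apply: eq_Rintegral => v; rewrite inE/= in_itv/= => v01; exact: CE.
Qed.

Lemma xi_block (R : realType) (L a : R) (C : R -> R -> R) :
  0 <= L <= 1 -> 0 <= a <= 1 ->
  (forall u v, 0 <= u <= 1 -> 0 <= v <= 1 -> C u v = block_copula L a u v) ->
  xi C = 1 - L ^+ 2 * (1 - a ^+ 2).
Proof.
move=> L01 a01 CE; rewrite -Rintegral_block_diag//; last first.
  by apply/andP; nra.
congr (_ * _ - _); apply: eq_Rintegral => v; rewrite inE/= in_itv/= => v01.
by have [] := sq_d1_block L01 a01 CE v01.
Qed.

(** * Fréchet copulas and ordinal sums of [Pi] *)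

Lemma frechet_block (R : realType) (a u v : R) : 0 <= u <= 1 -> 0 <= v <= 1 ->
  frechet a u v = block_copula 1 a u v.
Proof.
move=> /andP[u0 u1] /andP[v0 v1]; have [v1'|v1'] := ltP v 1.
  by rewrite block_copula_lt ?v0// (min_l u1) /frechet divr1; ring.
have -> : v = 1 by lra.
by rewrite block_copula_ge// /frechet (min_l u1); ring.
Qed.

Lemma block_ordinal_sum (R : realType) (L : R) : 0 <= L <= 1 ->
  ordinal_sum_of_Pi (block_copula L 0).
Proof.
move=> /andP[L0 L1].
(* The index set is empty for [L = 0], since a block must have positive length. *)
exists [set k | k = 0%N /\ 0 < L], (fun=> 0), (fun=> L); split.
  split; first by move=> k [_ L0'].
  split; first by move=> k l [-> _] [-> _].
  move=> k _; split=> [u u01|u1 u2 v1 v2 u10 u12 u21 v10 v12 v21].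
    by rewrite /Pi !(mulr0, mul0r, mulr1, mul1r).
  by rewrite /Pi; nra.
move=> u v /andP[u0 u1] /andP[v0 v1]; split.
  move=> k [_ Lgt0] /andP[_ uL] /andP[_ vL].
  rewrite block_copula_lt ?v0// (min_l (ltW uL)) /Pi.
  by field; rewrite gt_eqF.
move=> nin; rewrite /M; have [vL|Lv] := ltP v L; last by rewrite block_copula_ge.
have [uL|Lu] := ltP u L; last by rewrite block_copulaC block_copula_ge// minC.
rewrite block_copula_lt ?v0// (min_l (ltW uL)).
(* Points on the axes lie outside the open block, but there both formulas give [0]. *)
have [->|un0] := eqVneq u 0; first by rewrite min_l//; ring.
have [->|vn0] := eqVneq v 0; first by rewrite min_r//; ring.
exfalso; apply: nin; exists 0%N; split; first by split => //; exact: le_lt_trans vL.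
by rewrite !lt_neqAle (eq_sym 0) un0 u0 (eq_sym 0) vn0 v0 -!lt_neqAle.
Qed.

(** If [v] lies in the block [k], at relative height [s], the section has slopes [1], [s], [0]
    before, in and after the block, and [a k + s^2 (b k - a k)] is [C v v]. Otherwise the section is
    that of [M], and both sides are [v]. *)
Lemma ordinal_sum_of_Pi_sq_d1 (R : realType) (C : R -> R -> R) (v : R) :
  ordinal_sum_of_Pi C -> 0 <= v <= 1 -> sq_d1 C v = C v v.
Proof.
move=> [I [a [b [[ab [disj _]] CE]]]] /[dup] v01 /andP[v0 v1].
have [[k [Ik vk]]|nk] := pselect (exists k, I k /\ a k < v < b k).
  have [ak0 [akbk bk1]] := ab _ Ik; have /andP[akv vbk] := vk.
  (* By disjointness no other block contains [v], so [C u v] is [M u v] as soon as [u] leaves the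
     block [k]. *)
  have uniq u : ~ a k < u < b k ->
      ~ exists l, I l /\ a l < u < b l /\ a l < v < b l.
    move=> uk [l [Il [ul vl]]]; have [kl|kl] := eqVneq k l; first by rewrite kl in uk.
    have := disj _ _ Ik Il (elimN eqP kl).
    by rewrite -subset0 => /(_ v); apply; split; rewrite /= in_itv.
  pose s := (v - a k) / (b k - a k).
  have d0 : 0 < b k - a k by rewrite subr_gt0.
  have s0 : 0 <= s by rewrite divr_ge0 ?subr_ge0// ltW.
  have s1 : s <= 1 by rewrite ler_pdivrMr// mul1r lerD2r ltW.
  have E1 u : 0 < u < a k -> C u v = 0 + 1 * u.
    move=> ua; have u01 : 0 <= u <= 1 by apply/andP; lra.
    have [_ ->] := CE _ _ u01 v01; last by apply: uniq; lra.
    by rewrite /M min_l; lra.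
  have E2 u : a k < u < b k -> C u v = (a k - a k * s) + s * u.
    move=> uk; have u01 : 0 <= u <= 1 by apply/andP; lra.
    have [/(_ _ Ik uk vk) -> _] := CE _ _ u01 v01; rewrite /Pi /s.
    by field; rewrite gt_eqF.
  have E3 u : b k < u < 1 -> C u v = v + 0 * u.
    move=> ub; have u01 : 0 <= u <= 1 by apply/andP; lra.
    have [_ ->] := CE _ _ u01 v01; last by apply: uniq; lra.
    by rewrite /M min_r; lra.
  rewrite (sq_d1_piecewise_affine ak0 (ltW akbk) bk1 s1 s0 E1 E2 E3).
  have [/(_ _ Ik vk vk) -> _] := CE _ _ v01 v01; rewrite /Pi /s.
  by field; rewrite gt_eqF.
have CM u : 0 <= u <= 1 -> C u v = M u v.
  move=> u01; have [_ ->//] := CE _ _ u01 v01.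
  by move=> [k [Ik [_ vk]]]; apply: nk; exists k.
have E1 u : 0 < u < v -> C u v = 0 + 1 * u.
  by move=> uv; rewrite CM /M ?min_l; try apply/andP; lra.
have E2 u : v < u < v -> C u v = 0 + 0 * u by lra.
have E3 u : v < u < 1 -> C u v = v + 0 * u.
  by move=> uv; rewrite CM /M ?min_r; try apply/andP; lra.
rewrite (sq_d1_piecewise_affine v0 (lexx v) v1 ler01 (lexx 0) E1 E2 E3).
by rewrite CM// /M minxx; ring.
Qed.

(** * The attainable region and its boundary curves *)

Theorem mainTheorem3 (R : realType) :
  @R_SI R = [set p : R * R | 0 <= p.1 <= 1 /\ 0 <= p.2 <= 1 /\
                            p.1 <= p.2 /\ p.2 <= Num.sqrt p.1] /\
  (forall x : R, 0 <= x <= 1 ->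
     @C_SI R (frechet (Num.sqrt x)) /\
     xi (frechet (Num.sqrt x)) = x /\ psi (frechet (Num.sqrt x)) = Num.sqrt x /\
     (forall C, @C_SI R C -> xi C = x -> psi C = Num.sqrt x ->
        forall u v, 0 <= u <= 1 -> 0 <= v <= 1 ->
          C u v = frechet (Num.sqrt x) u v)) /\
  (forall C : R -> R -> R, ordinal_sum_of_Pi C -> xi C = psi C) /\
  (forall y : R, 0 <= y <= 1 ->
     exists C : R -> R -> R, ordinal_sum_of_Pi C /\ @C_SI R C /\
       xi C = y /\ psi C = y).
Proof.
have block (L a : R) : 0 <= L <= 1 -> 0 <= a <= 1 ->
    [/\ C_SI (block_copula L a), xi (block_copula L a) = 1 - L ^+ 2 * (1 - a ^+ 2) &
     psi (block_copula L a) = 1 - L ^+ 2 * (1 - a)].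
  by move=> L01 a01; split; [exact: block_C_SI L01 a01 _|exact: xi_block|exact: psi_block].
have O1 : 0 <= (1 : R) <= 1 by rewrite ler01 lexx.
have sqrt01 (x : R) : 0 <= x <= 1 -> 0 <= Num.sqrt x <= 1.
  by move=> /andP[x0 x1]; rewrite sqrtr_ge0 -sqrtr1 ler_wsqrtr.
split; last split; last split.
- apply/seteqP; split => [_ [C [copC si] <-]|[x y] /= [x01 [y01 [xy yx]]]] /=.
    have xp := xi_le_psi copC si; have px := psi_sqr_le_xi copC.
    have p1 := psi_le1 copC; have xi0 : 0 <= xi C by exact: le_trans (sqr_ge0 _) px.
    split; first by rewrite xi0 (le_trans xp).
    split; first by rewrite p1 (le_trans xi0).
    split => //; rewrite -[leLHS]ger0_norm ?(le_trans xi0)// -sqrtr_sqr.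
    exact: ler_wsqrtr.
  have /andP[x0 x1] := x01; have /andP[y0 y1] := y01.
  have y2x : y ^+ 2 <= x.
    by rewrite -(sqr_sqrtr x0) lerXn2r ?nnegrE ?sqrtr_ge0.
  (* The parameters below divide by [1 - y]. For [y = 1] also [x = 1], and the point is attained by
     [M], the case [L = 0]. *)
  have [yE|yn1] := eqVneq y 1.
    have xE : x = 1 by apply/eqP; rewrite eq_le x1 -(expr1n R 2) -yE.
    have O0 : 0 <= (0 : R) <= 1 by rewrite lexx ler01.
    have [si xiE psiE] := block 0 0 O0 O0.
    by exists (block_copula 0 0) => //; rewrite xiE psiE xE yE; congr pair; ring.
  have ylt1 : 0 < 1 - y by rewrite subr_gt0 lt_neqAle yn1.
  (* Solving [L^2 (1 - a^2) = 1 - x] and [L^2 (1 - a) = 1 - y] gives [1 + a = (1 - x) / (1 - y)] and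
     [1 - a = t / (1 - y)]. Then [a >= 0] amounts to [x <= y], and [L <= 1] to [y^2 <= x]. *)
  pose t := 1 - 2 * y + x.
  have yt : (1 - y) ^+ 2 <= t by rewrite /t; lra.
  have t0 : 0 < t by apply: lt_le_trans yt; rewrite exprn_gt0.
  pose a := (y - x) / (1 - y); pose L := Num.sqrt ((1 - y) ^+ 2 / t).
  have L2 : L ^+ 2 = (1 - y) ^+ 2 / t by rewrite sqr_sqrtr// divr_ge0 ?sqr_ge0// ltW.
  have L01 : 0 <= L <= 1.
    apply: sqrt01; rewrite divr_ge0 ?sqr_ge0 ?(ltW t0)//=.
    by rewrite ler_pdivrMr// mul1r.
  have a01 : 0 <= a <= 1.
    rewrite divr_ge0 ?subr_ge0//= ler_pdivrMr// mul1r.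
    by move: t0; rewrite /t; lra.
  have [si xiE psiE] := block L a L01 a01.
  exists (block_copula L a) => //; rewrite xiE psiE L2 /a.
  by congr pair; rewrite /t; field; rewrite gt_eqF//= gt_eqF.
- move=> x x01; have s01 := sqrt01 x x01.
  have fE := @frechet_block R (Num.sqrt x).
  have xiE : xi (frechet (Num.sqrt x)) = x.
    by rewrite (xi_block O1 s01 fE) sqr_sqrtr; [ring|case/andP: x01].
  have psiE : psi (frechet (Num.sqrt x)) = Num.sqrt x.
    by rewrite (psi_block O1 s01 fE); ring.
  split; first exact: block_C_SI O1 s01 fE.
  do 2?[split => //]; move=> C [copC _] xiC psiC u v u01 v01.
  apply: xi_psi_frechet => //; rewrite sqr_sqrtr ?xiC//.
  by case/andP: x01.
- move=> C oC; rewrite /xi /psi; congr (_ * _ - _).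
  apply: eq_Rintegral => v; rewrite inE/= in_itv/= => v01.
  exact: ordinal_sum_of_Pi_sq_d1.
(* With [a = 0] both [xi] and [psi] equal [1 - L^2], whence the choice of [L]. *)
- move=> y /[dup] y01 /andP[y0 y1]; pose L := Num.sqrt (1 - y).
  have L01 : 0 <= L <= 1 by apply: sqrt01; apply/andP; lra.
  have L2 : L ^+ 2 = 1 - y by rewrite sqr_sqrtr// subr_ge0.
  have O0 : 0 <= (0 : R) <= 1 by rewrite lexx ler01.
  have [si xiE psiE] := block L 0 L01 O0.
  exists (block_copula L 0); split; first exact: block_ordinal_sum.
  by split => //; rewrite xiE psiE L2; split; ring.
Qed.
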